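(* For every integer $n\ge 0$, there is a bijection between the set of isomorphism classes of $XY$-graphs on $n$ vertices with no isolates in $Y$ and the set of isomorphism classes of bipartite posets on $n$ elements which maps unbalanced $XY$-graphs to unbalanced bipartite posets and balanced $XY$-graphs to balanced bipartite posets.
   Context: An $XY$-graph is a bipartite graph with a specified ordered bipartition $X\cup Y$ of its vertices (edges join $X$ to $Y$); isomorphisms must map $X$ onto $X'$ and $Y$ onto $Y'$. A vertex of $Y$ is an isolate if it has no neighbor; a vertex of $X$ is universal if it is adjacent to every vertex of $Y$. An $XY$-graph with no isolates in $Y$ is unbalanced if $X$ has a universal vertex and balanced otherwise. A bipartite poset is a finite poset of height at most one (no $x\prec y\prec z$). An element $v$ has height 1 if some $u\prec v$, height 0 otherwise; a height-0 element is a full support point if it is comparable to every height-1 element. A bipartite poset is unbalanced if it has a full support point and balanced otherwise. Posets are considered up to isomorphism. *)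

(* Defs.v *)
From HB Require Import structures.
From mathcomp Require Import all_boot all_order.

Set Implicit Arguments.
Unset Strict Implicit.
Unset Printing Implicit Defensive.

(* [Y] is the complement of [xpart]; [xy_bip] says that every edge has exactly
   one end in each part, which also excludes loops. *)
Record xygraph := XYGraph {
  xy_vertex : finType;
  xpart : {set xy_vertex};
  adj : rel xy_vertex;
  xy_sym : symmetric adj;
  xy_bip : forall u v, adj u v -> (u \in xpart) != (v \in xpart)
}.

Definition ypart (G : xygraph) : {set xy_vertex G} := ~: xpart G.

Definition xy_order (G : xygraph) : nat := #|xy_vertex G|.

Definition xy_iso (G H : xygraph) : Prop :=
  exists f : xy_vertex G -> xy_vertex H,
    [/\ bijective f,
        {mono f : u v / adj u v},
        f @: xpart G = xpart H &
        f @: ypart G = ypart H].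

Definition isolate (G : xygraph) (y : xy_vertex G) : bool :=
  [forall v, ~~ adj y v].

Definition no_isolates (G : xygraph) : bool :=
  [forall y in ypart G, ~~ isolate y].

Definition universal (G : xygraph) (x : xy_vertex G) : bool :=
  [forall y in ypart G, adj x y].

Definition xy_unbalanced (G : xygraph) : bool :=
  no_isolates G && [exists x in xpart G, universal x].

Definition xy_balanced (G : xygraph) : bool :=
  no_isolates G && ~~ [exists x in xpart G, universal x].

Record bposet := BPoset {
  bp_disp : Order.disp_t;
  bp_elt : finPOrderType bp_disp;
  bp_bip : forall x y z : bp_elt, ~ ((x < y)%O /\ (y < z)%O)
}.

Definition bp_order (P : bposet) : nat := #|bp_elt P|.

Definition bp_iso (P Q : bposet) : Prop :=
  exists f : bp_elt P -> bp_elt Q,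
    bijective f /\ {mono f : x y / (x <= y)%O}.

Definition height1 (P : bposet) (v : bp_elt P) : bool :=
  [exists u : bp_elt P, (u < v)%O].

Definition height0 (P : bposet) (v : bp_elt P) : bool := ~~ height1 v.

Definition full_support_point (P : bposet) (u : bp_elt P) : bool :=
  height0 u && [forall v : bp_elt P, height1 v ==> (u >=< v)%O].

Definition bp_unbalanced (P : bposet) : bool :=
  [exists u : bp_elt P, full_support_point u].

Definition bp_balanced (P : bposet) : bool := ~~ bp_unbalanced P.

(* An isomorphism class is the predicate of being isomorphic to a given object.
   The classes range over all finite carriers, so they are plain predicates:
   [classical_sets.set] is confined to a universe below that of [finType]. *)
Definition xy_class (n : nat) : Type :=
  {C : xygraph -> Prop |
    exists G, [/\ xy_order G = n, no_isolates G & C = xy_iso G]}.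

Definition bp_class (n : nat) : Type :=
  {D : bposet -> Prop | exists P, bp_order P = n /\ D = bp_iso P}.

(* Main.v *)
Require Import Defs.
From HB Require Import structures.
From mathcomp Require Import all_boot all_order.
From Stdlib Require Import FunctionalExtensionality PropExtensionality.
From Stdlib Require Import ProofIrrelevance.

(** Directing every edge from [X] to [Y] turns an [XY]-graph into a poset of
    height at most one. When [Y] has no isolates, the elements of height 1 are
    exactly [Y], so the graph is recovered from the comparability relation and
    universal vertices are the full support points. Since an isomorphism class
    is a predicate, both maps on classes are defined as images, without
    choosing representatives. *)

Set Implicit Arguments.
Unset Strict Implicit.
Unset Printing Implicit Defensive.

Import Order.TTheory.

(** * Isomorphism as an equivalence, and its invariants *)

Lemma xy_iso_refl (G : xygraph) : xy_iso G G.
Proof. by exists id; split; rewrite ?imset_id //; exists id. Qed.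

Lemma xy_iso_sym (G H : xygraph) : xy_iso G H -> xy_iso H G.
Proof.
move=> [f [[g fK gK] adjf fX fY]]; exists g; split.
- by exists f.
- by move=> u v; rewrite -adjf !gK.
- by rewrite -fX -imset_comp (eq_imset _ fK) imset_id.
- by rewrite -fY -imset_comp (eq_imset _ fK) imset_id.
Qed.

Lemma xy_iso_trans (G H K : xygraph) : xy_iso G H -> xy_iso H K -> xy_iso G K.
Proof.
move=> [f [bf adjf fX fY]] [g [bg adjg gX gY]]; exists (g \o f); split.
- exact: bij_comp.
- by move=> u v /=; rewrite adjg adjf.
- by rewrite imset_comp fX.
- by rewrite imset_comp fY.
Qed.

Lemma bp_iso_refl (P : bposet) : bp_iso P P.
Proof. by exists id; split=> //; exists id. Qed.

Lemma bp_iso_sym (P Q : bposet) : bp_iso P Q -> bp_iso Q P.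
Proof.
move=> [f [[g fK gK] lef]]; exists g; split; first by exists f.
by move=> x y; rewrite -lef !gK.
Qed.

Lemma bp_iso_trans (P Q S : bposet) : bp_iso P Q -> bp_iso Q S -> bp_iso P S.
Proof.
move=> [f [bf lef]] [g [bg leg]]; exists (g \o f); split.
  exact: bij_comp.
by move=> x y /=; rewrite leg lef.
Qed.

Lemma mono_height1 (P Q : bposet) (f : bp_elt P -> bp_elt Q) :
  bijective f -> {mono f : x y / (x <= y)%O} ->
  forall x, height1 (f x) = height1 x.
Proof.
move=> [g fK gK] /leW_mono ltf x.
apply/existsP/existsP => [] [y yx]; last by exists (f y); rewrite ltf.
by exists (g y); rewrite -ltf gK.
Qed.

Lemma bp_iso_unbalanced (P Q : bposet) :
  bp_iso P Q -> bp_unbalanced P = bp_unbalanced Q.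
Proof.
(* One implication suffices, because isomorphism is symmetric. *)
suff imp (A B : bposet) : bp_iso A B -> bp_unbalanced A -> bp_unbalanced B.
  by move=> PQ; apply/idP/idP; apply: imp => //; apply: bp_iso_sym.
move=> [f [[g fK gK] lef]] /existsP [u /andP [u0 /forallP uP]].
have h1f := mono_height1 (Bijective fK gK) lef.
apply/existsP; exists (f u); rewrite /full_support_point {1}/height0 h1f.
rewrite -/(height0 u) u0 /=.
apply/forallP=> v; rewrite -[v]gK h1f; apply/implyP=> v1.
by have:= implyP (uP (g v)) v1; rewrite /Order.comparable !lef.
Qed.

(** * From graphs to posets *)

Section PosetOfGraph.
Variable G : xygraph.

(** The order depends on [G] and not only on its vertex type, so its instance is attached to this
    alias indexed by [G]. *)
Definition xy_poset_elt : Type := xy_vertex G.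

HB.instance Definition _ := Finite.on xy_poset_elt.

Definition xy_le : rel xy_poset_elt :=
  fun u v => (u == v) || [&& u \in xpart G, v \notin xpart G & adj u v].

Fact xy_le_refl : reflexive xy_le.
Proof. by move=> u; rewrite /xy_le eqxx. Qed.

Fact xy_le_anti : antisymmetric xy_le.
Proof.
move=> u v /andP [/orP [/eqP // | /and3P [uX vX _]]].
by case/orP=> [/eqP // | /and3P [vX']]; rewrite vX' in vX.
Qed.

Fact xy_le_trans : transitive xy_le.
Proof.
move=> v u w /orP [/eqP -> // | /and3P [uX vX uv]].
(* Two strict steps cannot be chained: the first puts [v] outside [xpart G], the second inside. *)
case/orP=> [/eqP <- | /and3P [vX']]; last by rewrite vX' in vX.
by rewrite /xy_le uX vX uv orbT.
Qed.

HB.instance Definition _ :=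
  Order.Le_isPOrder.Build (Order.Disp tt tt) xy_poset_elt
    xy_le_refl xy_le_anti xy_le_trans.

Lemma xy_ltE (u v : xy_poset_elt) :
  (u < v)%O = [&& u \in xpart G, v \notin xpart G & adj u v].
Proof.
rewrite lt_neqAle [(u <= v)%O]/(xy_le u v) /xy_le; case: eqVneq => //= <-.
by case: (u \in _).
Qed.

Fact xy_poset_bip (x y z : xy_poset_elt) : ~ ((x < y)%O /\ (y < z)%O).
Proof. by rewrite !xy_ltE => -[/and3P [_ /negPf -> _]]. Qed.

Definition xy_poset : bposet := BPoset xy_poset_bip.

(* The two finite structures on the carrier are not convertible, hence the
   detour through a bijection. *)
Lemma bp_order_xy_poset : bp_order xy_poset = xy_order G.
Proof.
by apply: (@bij_eq_card (bp_elt xy_poset) (xy_vertex G) id); exists id.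
Qed.

(** Without isolates, a vertex of Y has a neighbor; bipartiteness places it in X, hence strictly
    below. *)
Lemma height1_xy_poset (v : xy_vertex G) :
  no_isolates G -> height1 (P := xy_poset) v = (v \notin xpart G).
Proof.
move=> /forall_inP noG; apply/existsP/idP => [[u] | vY].
  by rewrite xy_ltE => /and3P [].
have /noG /forallPn [u] : v \in ypart G by rewrite /ypart inE.
rewrite negbK => vu; exists u; rewrite xy_ltE vY xy_sym vu !andbT.
by have := xy_bip vu; rewrite (negPf vY); case: (u \in _).
Qed.

(** Heights recover the two parts, and comparability across them is adjacency, so the full support
    points are exactly the universal vertices of X. *)
Lemma xy_poset_unbalanced :
  no_isolates G -> xy_unbalanced G = bp_unbalanced xy_poset.
Proof.
move=> noG; rewrite /xy_unbalanced noG andTb.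
have fspE u :
    full_support_point (P := xy_poset) u = (u \in xpart G) && universal u.
  rewrite /full_support_point /height0 height1_xy_poset // negbK.
  case uX: (u \in _) => //; rewrite !andTb.
  (* With [u] in X and [v] in Y, equality and [v < u] are excluded; only [u < v] remains. *)
  have supE v : v \notin xpart G -> ((u : xy_poset_elt) >=< v)%O = adj u v.
    move=> vX; have neq_uv : (u == v) = false.
      by apply/eqP => uv; rewrite -uv uX in vX.
    rewrite /Order.comparable !le_eqVlt [v == u]eq_sym neq_uv !xy_ltE.
    by rewrite uX vX (negPf vX) orbF.
  apply/forallP/forall_inP => uP v.
    rewrite /ypart inE => vX; rewrite -supE //.
    by apply: (implyP (uP v)); rewrite height1_xy_poset.
  apply/implyP; rewrite height1_xy_poset // => vX.
  by rewrite supE // uP // /ypart inE.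
by apply/exists_inP/existsP => [[u uX uU] | [u]];
  [exists u; rewrite fspE uX | rewrite fspE => /andP [uX uU]; exists u].
Qed.

End PosetOfGraph.

Lemma xy_poset_iso (G H : xygraph) :
  xy_iso G H -> bp_iso (xy_poset G) (xy_poset H).
Proof.
move=> [f [bf adjf fX _]]; exists f; split=> // u v.
have inX w : (f w \in xpart H) = (w \in xpart G).
  by rewrite -fX (mem_imset _ _ (bij_inj bf)).
rewrite -[LHS]/(@xy_le H (f u) (f v)) -[RHS]/(@xy_le G u v) /xy_le.
by rewrite (inj_eq (bij_inj bf)) !inX adjf.
Qed.

(** * From posets to graphs, and the round trips *)

Section GraphOfPoset.
Variable P : bposet.

Definition bp_xpart : {set bp_elt P} := [set v | height0 v].

Definition bp_adj : rel (bp_elt P) := fun u v => (u < v)%O || (v < u)%O.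

Fact bp_adj_sym : symmetric bp_adj.
Proof. by move=> u v; rewrite /bp_adj orbC. Qed.

(** An element below [u] would complete a chain of three. *)
Lemma lt_height (u v : bp_elt P) : (u < v)%O -> height0 u /\ height1 v.
Proof.
move=> uv; split; last by apply/existsP; exists u.
by apply/existsPn => w; apply/negP => wu; apply: (@bp_bip P w u v).
Qed.

Fact bp_adj_bip u v : bp_adj u v -> (u \in bp_xpart) != (v \in bp_xpart).
Proof.
by rewrite !inE; case/orP=> /lt_height [-> h]; rewrite /height0 h.
Qed.

Definition bp_graph : xygraph := XYGraph bp_adj_sym bp_adj_bip.

Lemma bp_graph_no_isolates : no_isolates bp_graph.
Proof.
apply/forall_inP => v; rewrite /ypart !inE negbK => /existsP [u uv].
by apply/forallPn; exists u; rewrite negbK /= /bp_adj uv orbT.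
Qed.

(** The identity works: forgetting the direction of a strict comparison loses nothing, since the
    heights of its ends restore it. *)
Lemma bp_graphK : bp_iso (xy_poset bp_graph) P.
Proof.
exists id; split=> [|u v]; first by exists id.
rewrite -[RHS]/(@xy_le bp_graph u v) /xy_le le_eqVlt; congr orb.
rewrite !inE /= /bp_adj; apply/idP/and3P => [uv | [u0 _ /orP [//|vu]]].
  by have [-> h] := lt_height uv; rewrite /height0 h uv.
by have [_ u1] := lt_height vu; rewrite /height0 u1 in u0.
Qed.

End GraphOfPoset.

Lemma bp_graph_iso (P Q : bposet) :
  bp_iso P Q -> xy_iso (bp_graph P) (bp_graph Q).
Proof.
move=> [f [bf lef]]; have [g fK gK] := bf.
have ltf : {mono f : x y / (x < y)%O} := leW_mono lef.
have h1f := mono_height1 bf lef.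
exists f; split=> //.
- by move=> u v; rewrite /= /bp_adj !ltf.
- apply/setP => x; rewrite -[x]gK (mem_imset _ _ (bij_inj bf)).
  by rewrite !inE /height0 h1f.
- apply/setP => x; rewrite -[x]gK (mem_imset _ _ (bij_inj bf)).
  by rewrite !inE /height0 h1f.
Qed.

(** The identity works again: [noG] makes height 0 coincide with membership in X. *)
Lemma xy_posetK (G : xygraph) :
  no_isolates G -> xy_iso (bp_graph (xy_poset G)) G.
Proof.
move=> noG; set B := bp_graph (xy_poset G).
have eX v : (v \in xpart B) = ((v : xy_vertex G) \in xpart G).
  by rewrite inE /height0 height1_xy_poset // negbK.
exists (id : xy_vertex B -> xy_vertex G); split.
- by exists id.
- move=> u v; rewrite /= /bp_adj !xy_ltE (@xy_sym G v u).
  (* An edge has exactly one end in X, so it is a strict comparison in one of the two directions; a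
     non-edge is one in neither. *)
  case uv: (@adj G u v); rewrite ?andbF //.
  by move: (xy_bip uv); do 2!case: (_ \in _).
- apply/setP => v; apply/imsetP/idP => [[u uX ->] | vX]; first by rewrite -eX.
  by exists v; rewrite ?eX.
- apply/setP => v; rewrite /ypart inE.
  apply/imsetP/idP => [[u uY ->] | vY]; first by rewrite -eX -in_setC.
  by exists v; rewrite ?in_setC ?eX.
Qed.

(** * Equality of classes and their images *)

Lemma pred_ext (T : Type) (A B : T -> Prop) : (forall x, A x <-> B x) -> A = B.
Proof.
move=> AB; apply: functional_extensionality => x.
exact: propositional_extensionality.
Qed.

(** Reduces equality in [xy_class n] and [bp_class n] to equality of the underlying predicates. *)
Lemma sval_inj (T : Type) (Q : T -> Prop) : injective (@sval T Q).
Proof.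
move=> [x p] [y q] /= xy; case: y / xy q => q.
by rewrite (proof_irrelevance _ p q).
Qed.

(** Since [xy_poset] respects isomorphism, the image of a class, closed under isomorphism, is again
    a single class. *)
Lemma xy_image_class (G : xygraph) (C : xygraph -> Prop) : C = xy_iso G ->
  (fun P => exists2 H, C H & bp_iso (xy_poset H) P) = bp_iso (xy_poset G).
Proof.
move=> ->; apply: pred_ext => P; split=> [[H GH HP] | GP].
  exact: bp_iso_trans (xy_poset_iso GH) HP.
by exists G => //; apply: xy_iso_refl.
Qed.

Lemma bp_image_class (P : bposet) (D : bposet -> Prop) : D = bp_iso P ->
  (fun G => exists2 Q, D Q & xy_iso (bp_graph Q) G) = xy_iso (bp_graph P).
Proof.
move=> ->; apply: pred_ext => G; split=> [[Q PQ QG] | PG].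
  exact: xy_iso_trans (bp_graph_iso PQ) QG.
by exists P => //; apply: bp_iso_refl.
Qed.

Lemma eq_xy_iso (G H : xygraph) : xy_iso G H -> xy_iso G = xy_iso H.
Proof.
move=> GH; apply: pred_ext => K; split; apply: xy_iso_trans => //.
exact: xy_iso_sym.
Qed.

Lemma eq_bp_iso (P Q : bposet) : bp_iso P Q -> bp_iso P = bp_iso Q.
Proof.
move=> PQ; apply: pred_ext => S; split; apply: bp_iso_trans => //.
exact: bp_iso_sym.
Qed.

(** * The mutually inverse maps on classes *)

Section Classes.
Variable n : nat.

Fact xy_image_classP (C : xy_class n) : exists P, bp_order P = n /\
  (fun P => exists2 H, sval C H & bp_iso (xy_poset H) P) = bp_iso P.
Proof.
have [G [Gn _ CG]] := svalP C; exists (xy_poset G).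
split; first by rewrite bp_order_xy_poset.
exact: xy_image_class.
Qed.

Definition poset_class (C : xy_class n) : bp_class n :=
  exist _ _ (xy_image_classP C).

Fact bp_image_classP (D : bp_class n) : exists G,
  [/\ xy_order G = n, no_isolates G &
   (fun G => exists2 Q, sval D Q & xy_iso (bp_graph Q) G) = xy_iso G].
Proof.
have [P [Pn DP]] := svalP D; exists (bp_graph P); split=> //.
  exact: bp_graph_no_isolates.
exact: bp_image_class.
Qed.

Definition graph_class (D : bp_class n) : xy_class n :=
  exist _ _ (bp_image_classP D).

Lemma poset_classK : cancel poset_class graph_class.
Proof.
move=> C; apply: sval_inj; case: (svalP C) => G [_ noG CG] /=.
(* The image of the image collapses to the class of [bp_graph (xy_poset G)]. *)
rewrite (bp_image_class (xy_image_class CG)) CG.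
exact/eq_xy_iso/xy_posetK.
Qed.

Lemma graph_classK : cancel graph_class poset_class.
Proof.
move=> D; apply: sval_inj; case: (svalP D) => P [_ DP] /=.
rewrite (xy_image_class (bp_image_class DP)) DP.
exact/eq_bp_iso/bp_graphK.
Qed.

(** Lets balance be compared on arbitrary members of corresponding classes: [G] and the witness [H]
    behind [P] are both isomorphic to [G0]. *)
Lemma poset_class_iso (C : xy_class n) (G : xygraph) (P : bposet) :
  sval C G -> sval (poset_class C) P -> bp_iso (xy_poset G) P.
Proof.
case: (svalP C) => G0 [_ _ CG0] CG [H CH HP].
apply: bp_iso_trans HP; apply: xy_poset_iso.
move: CG CH; rewrite CG0 => /xy_iso_sym; exact: xy_iso_trans.
Qed.

End Classes.

Theorem theorem5p3 (n : nat) :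
  exists f : xy_class n -> bp_class n,
    bijective f /\
    forall (C : xy_class n) (G : xygraph) (P : bposet),
      sval C G -> sval (f C) P ->
      (xy_unbalanced G -> bp_unbalanced P) /\
      (xy_balanced G -> bp_balanced P).
Proof.
exists (@poset_class n); split.
  by exists (@graph_class n); [apply: poset_classK | apply: graph_classK].
move=> C G P CG CP; have GP := poset_class_iso CG CP.
(* Invariance under isomorphism replaces [P] by [xy_poset G]; either assumption on [G] includes the
   absence of isolates. *)
rewrite /bp_balanced -(bp_iso_unbalanced GP); split=> [unbG | /andP [noG balG]].
  by rewrite -xy_poset_unbalanced //; case/andP: unbG.
by rewrite -xy_poset_unbalanced // /xy_unbalanced noG.
Qed.
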